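(* Let $k\ge n\ge 0$ be integers, and let $c_{n,k}=\inf\{r\ge 0\mid \text{there exists an odd map } S^k\to \mathrm{VR}(S^n;r)\}$. Any odd function $f\colon S^k\to S^n$ has modulus of discontinuity $\delta(f)\ge c_{n,k}$, and this bound is tight: for every $\varepsilon>0$ there exists an odd function $f\colon S^k\to S^n$ with modulus of discontinuity $\delta(f)\le c_{n,k}+\varepsilon$.
   Context: $S^n=\{x\in\mathbb{R}^{n+1}\mid \|x\|=1\}$ carries the geodesic metric $d_{S^n}(x,x')=\arccos\langle x,x'\rangle$ (so $S^0$ has diameter $\pi$), with involution $x\mapsto -x$. A ''function'' may be discontinuous; a ''map'' is a continuous function. A function between spaces with involutions (both written $x\mapsto -x$) is odd if $f(-x)=-f(x)$ for all $x$. For a metric space $X$ and $r\ge 0$, the Vietoris--Rips complex $\mathrm{VR}(X;r)$ is the simplicial complex with vertex set $X$ whose simplices are the nonempty finite subsets $\sigma\subseteq X$ with $\operatorname{diam}(\sigma)\le r$; it is identified with its geometric realization. If $X$ has an isometric involution $x\mapsto -x$, then $\mathrm{VR}(X;r)$ has the involution $-\left(\sum_i\lambda_i x_i\right)=\sum_i\lambda_i(-x_i)$. For a function $f\colon X\to Y$ from a topological space to a metric space, the modulus of discontinuity is $\delta(f)=\inf\{\delta\ge0\mid \forall x\in X\ \exists \text{ an open neighborhood } U_x \text{ of } x \text{ with } \operatorname{diam}(f(U_x))\le\delta\}$. *)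

(* Defs.v *)
From HB Require Import structures.
From mathcomp Require Import all_boot all_order all_algebra.
From mathcomp Require Import all_classical all_reals all_analysis.
From mathcomp Require Import ring.

Set Implicit Arguments.
Unset Strict Implicit.
Unset Printing Implicit Defensive.

Import Order.TTheory GRing.Theory Num.Theory.
Local Open Scope classical_set_scope.
Local Open Scope ring_scope.

HB.mixin Record hasInvolution T := {
  antip : T -> T;
  antipK : involutive antip
}.

#[short(type="involutiveType")]
HB.structure Definition Involutive := { T of hasInvolution T }.

HB.mixin Record isIsometricInvolution (R : numDomainType) T
    & Metric R T & hasInvolution T := {
  mdist_antip : forall x y : T, mdist (antip x) (antip y) = mdist x y :> R
}.

#[short(type="involutiveMetricType")]
HB.structure Definition InvolutiveMetric (R : numDomainType) :=
  { T of Metric R T & hasInvolution T & isIsometricInvolution R T }.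

Definition odd_function (X Y : involutiveType) (f : X -> Y) : Prop :=
  forall x, f (antip x) = antip (f x).

(* Extended-real valued, so that unbounded sets have diameter +oo. *)
Definition diam (R : realType) (X : metricType R) (A : set X) : \bar R :=
  ereal_sup [set (mdist x y)%:E | x in A & y in A].

Definition modulus_of_discontinuity (R : realType) (X : topologicalType)
    (Y : metricType R) (f : X -> Y) : \bar R :=
  ereal_inf [set d%:E | d in [set d : R | 0 <= d /\
    forall x, exists U : set X, [/\ open U, U x & (diam (f @` U) <= d%:E)%E]]].

Record simplicialComplex (V : Type) := SimplicialComplex {
  simplex :> set (set V);
  simplex_finite : forall s, simplex s -> finite_set s;
  simplex_nonempty : forall s, simplex s -> s !=set0;
  simplex_face : forall s t, simplex s -> t `<=` s -> t !=set0 -> simplex t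
}.

(* A point is a formal convex combination of the vertices of a simplex, given
   by its barycentric coordinates; the finitely supported sum over all
   vertices is the finite sum over that simplex. *)
Record realization (R : realType) (V : choiceType) (K : simplicialComplex V) :=
  RealizationPoint {
    bary :> V -> R;
    bary_ge0 : forall v, 0 <= bary v;
    bary_simplex : simplex K [set v | bary v != 0];
    bary_sum1 : \sum_(v \in [set: V]) bary v = 1
  }.

Lemma realization_eq (R : realType) (V : choiceType) (K : simplicialComplex V)
  (p q : realization R K) : bary p =1 bary q -> p = q.
Proof.
case: p q => [p p0 pK p1] [q q0 qK q1] /= /funext epq.
by subst q; congr RealizationPoint; apply: Prop_irrelevance.
Qed.

Section realization_topology.
Variables (R : realType) (V : choiceType) (K : simplicialComplex V).

HB.instance Definition _ := gen_eqMixin (realization R K).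
HB.instance Definition _ := gen_choiceMixin (realization R K).

Definition closed_simplex (s : set V) : set (realization R K) :=
  [set p | [set v | bary p v != 0] `<=` s].

(* The weak (coherent) topology: a set is open when its trace on every closed
   simplex is open in the Euclidean topology of that simplex, described here by
   the sup distance between barycentric coordinates. *)
Definition realization_open (U : set (realization R K)) : Prop :=
  forall s, simplex K s -> forall p, (closed_simplex s `&` U) p ->
    exists2 e : R, 0 < e & forall q, closed_simplex s q ->
      (forall v, `|bary p v - bary q v| < e) -> U q.

Lemma realization_openT : realization_open setT.
Proof. by move=> s _ p _; exists 1. Qed.

Lemma realization_openI (A B : set (realization R K)) :
  realization_open A -> realization_open B -> realization_open (A `&` B).
Proof.
move=> oA oB s Ks p [sp [Ap Bp]].
have [d d0 dA] := oA s Ks p (conj sp Ap).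
have [e e0 eB] := oB s Ks p (conj sp Bp).
exists (Num.min d e); first by rewrite lt_min d0 e0.
move=> q sq pq; split.
- by apply: dA => // v; apply: lt_le_trans (pq v) _; rewrite ge_min lexx.
- by apply: eB => // v; apply: lt_le_trans (pq v) _; rewrite ge_min lexx orbT.
Qed.

Lemma realization_open_bigU (I : Type) (F : I -> set (realization R K)) :
  (forall i, realization_open (F i)) -> realization_open (\bigcup_i F i).
Proof.
move=> oF s Ks p [sp [i _ Fip]].
have [e e0 eF] := oF i s Ks p (conj sp Fip).
by exists e => // q sq pq; exists i => //; apply: eF.
Qed.

HB.instance Definition _ := @isOpenTopological.Build (realization R K)
  realization_open realization_openT realization_openI realization_open_bigU.

End realization_topology.

Section vietoris_rips.
Variables (R : realType) (X : metricType R) (r : R).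

Definition vietoris_rips_simplex : set (set X) :=
  [set s | [/\ finite_set s, s !=set0 & (diam s <= r%:E)%E]].

Lemma vietoris_rips_finite s : vietoris_rips_simplex s -> finite_set s.
Proof. by case. Qed.

Lemma vietoris_rips_nonempty s : vietoris_rips_simplex s -> s !=set0.
Proof. by case. Qed.

Lemma vietoris_rips_face s t :
  vietoris_rips_simplex s -> t `<=` s -> t !=set0 -> vietoris_rips_simplex t.
Proof.
move=> [fs _ ds] ts t0; split=> //; first exact: sub_finite_set fs.
apply: le_trans ds; apply: ereal_sup_le => _ [x tx [y ty <-]].
by exists x; [exact: ts|exists y => //; exact: ts].
Qed.

Definition vietoris_rips : simplicialComplex X :=
  SimplicialComplex vietoris_rips_finite vietoris_rips_nonempty
    vietoris_rips_face.

Definition VR := realization R vietoris_rips.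

HB.instance Definition _ := Topological.on VR.

End vietoris_rips.

Section vietoris_rips_involution.
Variables (R : realType) (X : involutiveMetricType R) (r : R).

Let neg := @antip X.

Lemma antip_support (p : VR X r) :
  [set x | bary p (neg x) != 0] = neg @` [set x | bary p x != 0].
Proof.
apply/seteqP; split => [x /= px|_ [x /= px <-]].
  by exists (neg x) => //; exact: antipK.
by rewrite /= /neg antipK.
Qed.

Lemma VR_antip_ge0 (p : VR X r) x : 0 <= bary p (neg x).
Proof. exact: bary_ge0. Qed.

Lemma VR_antip_simplex (p : VR X r) :
  simplex (vietoris_rips X r) [set x | bary p (neg x) != 0].
Proof.
rewrite antip_support; have [fp [x px] dp] := bary_simplex p.
split; [exact: finite_image|by exists (neg x), x|].
apply: le_trans dp; apply: ereal_sup_le.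
move=> _ [_ [a pa <-] [_ [b pb <-] <-]].
by exists a => //; exists b => //; rewrite mdist_antip.
Qed.

Lemma VR_antip_sum1 (p : VR X r) : \sum_(x \in [set: X]) bary p (neg x) = 1.
Proof.
rewrite -(bary_sum1 p) [RHS](reindex_fsbigT neg)//.
exact: inv_bij (@antipK X).
Qed.

(* The coefficient at x of the sum of the l_i (- x_i) is that at - x of the sum
   of the l_i x_i. *)
Definition VR_antip (p : VR X r) : VR X r :=
  RealizationPoint (VR_antip_ge0 p) (VR_antip_simplex p) (VR_antip_sum1 p).

Lemma VR_antipK : involutive VR_antip.
Proof. by move=> p; apply: realization_eq => x /=; rewrite /neg antipK. Qed.

HB.instance Definition _ := hasInvolution.Build (VR X r) VR_antipK.

End vietoris_rips_involution.

Definition dot (R : realType) m (x y : 'rV[R]_m) : R :=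
  \sum_(i < m) x ord0 i * y ord0 i.

Definition euclidean_norm (R : realType) m (x : 'rV[R]_m) : R :=
  Num.sqrt (dot x x).

Record sphere (R : realType) (n : nat) := SpherePoint {
  sphere_vec :> 'rV[R]_n.+1;
  sphere_norm : euclidean_norm sphere_vec == 1
}.

HB.instance Definition _ (R : realType) (n : nat) :=
  [isSub for @sphere_vec R n].
HB.instance Definition _ (R : realType) (n : nat) :=
  [Choice of sphere R n by <:].

Section dot_theory.
Variables (R : realType) (m : nat).
Implicit Types x y z : 'rV[R]_m.

Lemma dotC x y : dot x y = dot y x.
Proof. by apply: eq_bigr => i _; rewrite mulrC. Qed.

Lemma dotDl x y z : dot (x + y) z = dot x z + dot y z.
Proof. by rewrite -big_split; apply: eq_bigr => i _; rewrite mxE mulrDl. Qed.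

Lemma dotZl a x y : dot (a *: x) y = a * dot x y.
Proof. by rewrite mulr_sumr; apply: eq_bigr => i _; rewrite mxE mulrA. Qed.

Lemma dotNl x y : dot (- x) y = - dot x y.
Proof. by rewrite -scaleN1r dotZl mulN1r. Qed.

Lemma dotDr x y z : dot x (y + z) = dot x y + dot x z.
Proof. by rewrite dotC dotDl !(dotC x). Qed.

Lemma dotZr a x y : dot x (a *: y) = a * dot x y.
Proof. by rewrite dotC dotZl dotC. Qed.

Lemma dotNr x y : dot x (- y) = - dot x y.
Proof. by rewrite dotC dotNl dotC. Qed.

Lemma dotxx_ge0 x : 0 <= dot x x.
Proof. by apply: sumr_ge0 => i _; rewrite -expr2 sqr_ge0. Qed.

Lemma dotxx_eq0 x : dot x x = 0 -> x = 0.
Proof.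
move/eqP; rewrite psumr_eq0 => [/allP x0|i _]; last by rewrite -expr2 sqr_ge0.
apply/rowP => i; rewrite mxE.
by move: (x0 i (mem_index_enum i)) => /=; rewrite -expr2 sqrf_eq0 => /eqP.
Qed.

Lemma dot_CauchySchwarz x y : dot x y ^+ 2 <= dot x x * dot y y.
Proof.
have [/eqP/dotxx_eq0 ->|y0] := boolP (dot y y == 0).
  by rewrite -(scale0r 0) !dotZr !mul0r expr0n mulr0.
have yy : 0 < dot y y by rewrite lt_def y0 dotxx_ge0.
have := dotxx_ge0 (dot y y *: x - dot x y *: y).
rewrite !(dotDl, dotDr, dotNl, dotNr, dotZl, dotZr) (dotC y x).
rewrite [X in 0 <= X](_ : _ = dot y y * (dot x x * dot y y - dot x y ^+ 2));
  last by ring.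
by rewrite pmulr_rge0// subr_ge0.
Qed.

End dot_theory.

Section sphere_metric.
Variables (R : realType) (n : nat).
Implicit Types x y z : sphere R n.

Lemma sphere_dotxx x : dot x x = 1.
Proof.
have /eqP := sphere_norm x; rewrite /euclidean_norm => h.
by rewrite -(sqr_sqrtr (dotxx_ge0 x)) h expr1n.
Qed.

Lemma sphere_dot_bound x y : -1 <= dot x y <= 1.
Proof.
rewrite -ler_norml -(@ler_pXn2r _ 2)// ?nnegrE// expr1n.
rewrite real_normK ?num_real//.
by have := dot_CauchySchwarz x y; rewrite !sphere_dotxx mulr1.
Qed.

Definition geodesic_dist x y : R := acos (dot x y).

Lemma geodesic_distxx x : geodesic_dist x x = 0.
Proof. by rewrite /geodesic_dist sphere_dotxx acos1. Qed.

Lemma geodesic_dist_positivity x y : geodesic_dist x y = 0 -> x = y.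
Proof.
rewrite /geodesic_dist => h.
have xy1 : dot x y = 1.
  by rewrite -(acosK (x := dot x y)) ?in_itv/= ?sphere_dot_bound// h cos0.
apply/val_inj/eqP; rewrite -subr_eq0; apply/eqP/dotxx_eq0.
rewrite !(dotDl, dotDr, dotNl, dotNr) (dotC (val y)) !sphere_dotxx /= xy1.
by rewrite opprK subrr addNr addr0.
Qed.

Lemma geodesic_dist_sym x y : geodesic_dist x y = geodesic_dist y x.
Proof. by rewrite /geodesic_dist dotC. Qed.

Lemma geodesic_dist_triangle y x z :
  geodesic_dist x z <= geodesic_dist x y + geodesic_dist y z.
Proof.
rewrite /geodesic_dist.
have bxy := sphere_dot_bound x y; have byz := sphere_dot_bound y z.
have bxz := sphere_dot_bound x z.
have [/ltW le_pi|le_pi] := ltP pi (acos (dot x y) + acos (dot y z)).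
  by apply: le_trans le_pi; apply: acos_lepi.
rewrite leNgt; apply/negP => lt_xz.
have : cos (acos (dot x z)) < cos (acos (dot x y) + acos (dot y z)).
  by rewrite ltr_cos ?in_itv/= ?addr_ge0 ?acos_ge0 ?acos_lepi.
rewrite cosD !sin_acos// !acosK ?in_itv//=.
set a := dot x y; set b := dot y z; rewrite ltNge => /negP; apply.
pose u := val x - a *: val y; pose v := val z - b *: val y.
have uu : dot u u = 1 - a ^+ 2.
  rewrite /u !(dotDl, dotDr, dotNl, dotNr, dotZl, dotZr) (dotC (val y) (val x)).
  by rewrite !sphere_dotxx -/a; ring.
have vv : dot v v = 1 - b ^+ 2.
  rewrite /v !(dotDl, dotDr, dotNl, dotNr, dotZl, dotZr).
  by rewrite (dotC (val z) (val y)) !sphere_dotxx -/b; ring.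
have uv : dot u v = dot x z - a * b.
  rewrite /u /v !(dotDl, dotDr, dotNl, dotNr, dotZl, dotZr).
  by rewrite !sphere_dotxx -/a -/b; ring.
have : `|dot u v| <= Num.sqrt (dot u u) * Num.sqrt (dot v v).
  rewrite -sqrtrM ?dotxx_ge0// -sqrtr_sqr.
  by apply: ler_wsqrtr; apply: dot_CauchySchwarz.
by rewrite uu vv uv ler_norml => /andP[+ _]; rewrite lerBrDl.
Qed.

HB.instance Definition _ := @isMetric.Build R (sphere R n) geodesic_dist
  geodesic_distxx geodesic_dist_positivity geodesic_dist_sym
  geodesic_dist_triangle.

Lemma sphere_antip_norm x : euclidean_norm (- val x) == 1.
Proof. by rewrite /euclidean_norm dotNl dotNr opprK; exact: sphere_norm. Qed.

Definition sphere_antip x : sphere R n := SpherePoint (sphere_antip_norm x).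

Lemma sphere_antipK : involutive sphere_antip.
Proof. by move=> x; apply/val_inj; rewrite /= opprK. Qed.

HB.instance Definition _ := hasInvolution.Build (sphere R n) sphere_antipK.

Lemma geodesic_dist_antip x y :
  mdist (antip x) (antip y) = mdist x y :> R.
Proof.
by congr acos; rewrite /antip /= /sphere_antip /= dotNl dotNr opprK.
Qed.

HB.instance Definition _ :=
  isIsometricInvolution.Build R (sphere R n) geodesic_dist_antip.

End sphere_metric.

(* c_{n,k}. It is finite: for r = pi, the constant map at the midpoint of a pair
   of antipodal points is odd. *)
Definition odd_map_threshold (R : realType) (n k : nat) : \bar R :=
  ereal_inf [set r%:E | r in [set r : R | 0 <= r /\
    exists f : sphere R k -> VR (sphere R n) r,
      continuous f /\ odd_function f]].

(* Main.v *)
Require Import Defs.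
From mathcomp Require Import all_boot all_order all_algebra.
From mathcomp Require Import all_classical all_reals all_analysis.
From mathcomp Require Import lra.

(** The theorem compares two ways of trading an odd function f : S^k -> S^n for
an odd map g : S^k -> VR(S^n; r), one for each direction.

From functions to maps ([odd_map_of_odd_function]). Suppose that every point of
S^k has an open neighborhood whose image under f has diameter at most r. As
S^k is compact, there is a single e > 0 such that f sends every e-ball to a set
of diameter at most r. Take a finite e/2-net s of S^k that is closed under the
involution, and the partition of unity given by the tent functions of radius
e/2 centered at the points of s. Then
  g(x) = sum over p in s of (weight of p at x) f(p)
is a point of VR(S^n; r), since only the p within e/2 of x count; near x all
the values of g lie in one closed simplex and the coordinates are continuous,
so g is continuous for the weak topology. It is odd because s, the metric and f
are compatible with the involutions. Hence every r that is admissible for the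
modulus of discontinuity of f is admissible for c_{n,k}, with no loss.

From maps to functions ([diam_dominant_vertex]). Given an odd map g to
VR(S^n; r), let f(x) be a vertex at which the barycentric coordinate of g(x) is
largest. When q is close to a point p of the complex, the vertices that are not
in the support of p have a small coordinate in q, so the dominant vertices of q
belong to the support of p ([near_dominant_vertex]). Thus near x the function f
takes its values in the support of g(x), a set of diameter at most r, and its
modulus of discontinuity is at most r. Ties between dominant vertices can be
broken oddly, because the involution of S^k has no fixed point
([odd_selection]). It remains to take r < c_{n,k} + eps. *)

Set Implicit Arguments.
Unset Strict Implicit.
Unset Printing Implicit Defensive.

Import Order.TTheory GRing.Theory Num.Theory.
Import numFieldNormedType.Exports.
Local Open Scope classical_set_scope.
Local Open Scope ring_scope.

(** * The sphere *)

Lemma sum_continuous (R : realType) (T : topologicalType) (I : Type)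
    (r : seq I) (P : pred I) (F : I -> T -> R) :
  (forall i, P i -> continuous (F i)) ->
  continuous (fun x => \sum_(i <- r | P i) F i x).
Proof. by apply: continuous_big; exact: add_continuous. Qed.

Section sphere_compact.
Variables (R : realType) (n : nat).

Lemma dot_continuous m (v : 'rV[R]_m) : continuous (dot v).
Proof.
have vw i : continuous (fun w : 'rV[R]_m => v ord0 i * w ord0 i).
  by move=> w; exact: (cvgMl_tmp (@coord_continuous _ _ _ ord0 i w)).
exact: sum_continuous.
Qed.

(** The geodesic topology is coarser than (in fact equal to) the topology
induced by the ambient space: a geodesic ball around x contains the cap of the
points y with [dot x y] larger than the cosine of its radius. *)
Lemma nbhs_sphere (x : sphere R n) (B : set (sphere R n)) :
  nbhs x B -> \forall w \near val x, forall y : sphere R n, val y = w -> B y.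
Proof.
move=> /nbhs_ballP[e e0 xB].
(* the cosine is monotone up to pi only *)
pose e' := Num.min e pi.
have e'0 : 0 < e' by rewrite lt_min e0 pi_gt0.
have e'pi : e' <= pi by rewrite ge_min lexx orbT.
have ce' : cos e' < dot (val x) (val x).
  by rewrite sphere_dotxx -cos0 ltr_cos// in_itv/= ?lexx ?pi_ge0// ltW.
near=> w => y yw; apply: xB; rewrite ballEmdist/=.
rewrite (@lt_le_trans _ _ e')//; last by rewrite ge_min lexx.
have yx := sphere_dot_bound x y.
rewrite /mdist/= /geodesic_dist -ltr_cos ?in_itv/=
  ?acos_ge0 ?acos_lepi ?(ltW e'0)//.
rewrite acosK ?in_itv//= yw; near: w.
exact: cvgr_gt (@dot_continuous _ _ _) _ ce'.
Unshelve. all: by end_near. Qed.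

(** The unit sphere of the ambient space is closed and bounded, and cluster
points of a filter can be lifted from it by [nbhs_sphere]. *)
Lemma sphere_compact : compact [set: sphere R n].
Proof.
pose S := [set v : 'rV[R]_n.+1 | dot v v = 1].
have cS : compact S.
  apply: bounded_closed_compact.
    exists 1; split=> // M M1 v vS; apply: le_trans (ltW M1).
    rewrite [leLHS]/Num.norm/= mx_normrE; apply: bigmax_le => // -[i j] _ /=.
    rewrite ord1 -(@ler_pXn2r _ 2)// ?nnegrE// expr1n real_normK ?num_real//.
    rewrite -vS /dot (bigD1 j)//= -expr2 lerDl sumr_ge0// => ? _.
    by rewrite -expr2 sqr_ge0.
  apply: (closed_comp (f := fun v => dot v v) (D := [set 1])).
    have vv (i : 'I_n.+1) :
        continuous (fun v : 'rV[R]_n.+1 => v ord0 i * v ord0 i).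
      move=> v; have vi := @coord_continuous R _ _ ord0 i v.
      exact: (cvgM vi vi).
    by move=> v _; apply: sum_continuous.
  exact: closed_eq.
move=> F PF _.
have [|v [vS clv]] := cS (val @ F) _.
  by apply: (@filterE _ F) => x; exact: sphere_dotxx.
have vn : euclidean_norm v == 1 by rewrite /euclidean_norm vS sqrtr1.
exists (SpherePoint vn); split=> // A B FA /nbhs_sphere vB.
have [|w [[x Ax <-] /(_ _ erefl)]] := clv (val @` A) _ _ vB; last by exists x.
by apply: (@filterS _ F _ A) => // x Ax; exists x.
Qed.

End sphere_compact.

Lemma sphere_antip_neq (R : realType) (n : nat) (x : sphere R n) : antip x != x.
Proof.
apply/eqP => /(congr1 (fun y : sphere R n => dot x y)).
rewrite sphere_dotxx /antip/= dotNr sphere_dotxx; lra.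
Qed.

Lemma sphere_nonempty (R : realType) (n : nat) : exists x : sphere R n, True.
Proof.
have e1 : euclidean_norm (delta_mx ord0 ord0 : 'rV[R]_n.+1) == 1.
  rewrite /euclidean_norm /dot (bigD1 ord0)//= big1 => [|i /negPf i0].
    by rewrite !mxE !eqxx mulr1 addr0 sqrtr1.
  by rewrite !mxE i0 andbF mulr0.
by exists (SpherePoint e1).
Qed.

(** * Compact metric spaces *)

Lemma le_diam (R : realType) (X : metricType R) (A B : set X) :
  A `<=` B -> (diam A <= diam B)%E.
Proof.
move=> AB; apply: ereal_sup_le => _ [x Ax [y Ay <-]].
by exists x; [exact: AB|exists y => //; exact: AB].
Qed.

Section compact_metric.
Variables (R : realType) (X : metricType R).
Hypothesis cptX : compact [set: X].

(** Lebesgue number lemma, for a property of sets that passes to subsets: if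
small enough balls around each point have it, so do all balls of a common
radius. *)
Lemma compact_lebesgue_number (P : set X -> Prop) :
  (forall A B, A `<=` B -> P B -> P A) ->
  (forall x, exists2 e : R, 0 < e & P (ball x e)) ->
  exists2 e : R, 0 < e & forall x, P (ball x e).
Proof.
move=> Pmon locP.
have : \forall e \near (0:R)^'+, [set: X] `<=` [set x | P (ball x e)].
  apply: (iffLR (compact_near_coveringP _) cptX) => x _.
  have [e e0 Pe] := locP x.
  near=> y e' => /=; apply: Pmon Pe => z yz; rewrite (splitr e).
  apply: (@ball_triangle _ _ y); first by near: y; apply: nbhsx_ballx; lra.
  apply: le_ball yz; near: e'; apply: nbhs_right_le; lra.
move=> nearP.
have [e [/= e0 Pe]] : exists e : R,
    0 < e /\ [set: X] `<=` [set x | P (ball x e)].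
  apply: (@filter_ex _ (0:R)^'+); near=> e; split; last by near: e.
  by near: e; exact: nbhs_right_gt.
by exists e => // x; exact: Pe.
Unshelve. all: by end_near. Qed.

Lemma compact_finite_net (e : R) : 0 < e ->
  exists s : seq X, forall x, exists2 p, p \in s & ball p e x.
Proof.
move=> e0.
(* the filter of the sequences that contain any prescribed points: near x, a
   large sequence meets the e-ball around any y since it contains x *)
pose F : set_system (seq X) :=
  filter_from setT (fun s0 : seq X => [set s : seq X | {subset s0 <= s}]).
have FF : Filter F.
  apply: filter_from_filter; first by exists [::].
  move=> s t _ _; exists (s ++ t) => // u su; split => x xs; apply: su.
    by rewrite mem_cat xs.
  by rewrite mem_cat xs orbT.
have [s _ /(_ s (fun _ => id)) sP] : \forall s \near F,
    [set: X] `<=` [set x | exists2 p, p \in s & ball p e x].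
  apply: (iffLR (compact_near_coveringP _) cptX) => x _.
  exists (ball x e, [set s : seq X | {subset [:: x] <= s}]).
    by split; [exact: nbhsx_ballx|exists [:: x]].
  move=> [y s] [/= xy xs]; exists x => //; apply: xs; exact: mem_head.
by exists s => x; exact: sP.
Qed.

End compact_metric.

(** * From odd functions to odd maps *)

Section partition_of_unity.
Variables (R : realType) (X : metricType R) (Y : metricType R) (f : X -> Y).
Variables (s : seq X) (e : R).
Hypothesis e_gt0 : 0 < e.
Hypothesis s_net : forall x, exists2 p, p \in s & ball p e x.

(** Unlike the indicator function of the ball, this is continuous in x. *)
Definition tent (p x : X) : R := Num.max (e - mdist p x) 0.

Definition total_tent (x : X) : R := \sum_(p <- s) tent p x.

(** The barycentric coordinate at v of the convex combination of the f p, where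
p ranges over s, with the normalized tents as coefficients; several p may have
the same image v. *)
Definition weight (x : X) (v : Y) : R :=
  (\sum_(p <- s | f p == v) tent p x) / total_tent x.

Lemma tent_ge0 p x : 0 <= tent p x.
Proof. by rewrite le_max lexx orbT. Qed.

Lemma tent_eq0 p x : e <= mdist p x -> tent p x = 0.
Proof. by move=> ep; apply/max_idPr; rewrite subr_le0. Qed.

Lemma total_tent_gt0 x : 0 < total_tent x.
Proof.
have [p ps px] := s_net x.
rewrite /total_tent (big_rem p)//= ltr_pwDl ?sumr_ge0// => [|q _].
  by rewrite lt_max subr_gt0; move: px; rewrite ballEmdist/= => ->.
exact: tent_ge0.
Qed.

Lemma weight_ge0 x v : 0 <= weight x v.
Proof.
apply: divr_ge0; last exact/ltW/total_tent_gt0.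
by apply: sumr_ge0 => p _; exact: tent_ge0.
Qed.

Lemma weight_neq0 x v :
  weight x v != 0 -> exists p, [/\ p \in s, f p = v & mdist p x < e].
Proof.
apply: contra_neqP => /forallNP nx; rewrite /weight big1_seq ?mul0r// => p.
move=> /andP[/eqP fp ps]; apply: tent_eq0; rewrite leNgt; apply/negP => px.
exact: (nx p).
Qed.

(** Only finitely many v count, and exchanging the sums over v and p gives the
total of all the tents. *)
Lemma weight_sum1 x : \sum_(v \in [set: Y]) weight x v = 1.
Proof.
pose r := undup [seq f p | p <- s].
have fr p : p \in s -> f p \in r by move=> ps; rewrite mem_undup map_f.
rewrite -(fsbig_widen [set` r])//= => [|v [_ vr]]; last first.
  apply/eqP; apply: contra_notT vr => /weight_neq0[p [ps <- _]]; exact: fr.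
rewrite -fsbig_seq ?undup_uniq// -mulr_suml.
have -> : \sum_(v <- r) \sum_(p <- s | f p == v) tent p x = total_tent x.
  under eq_bigr do rewrite big_mkcond/=.
  rewrite exchange_big/= /total_tent !big_seq; apply: eq_bigr => p ps.
  rewrite (bigD1_seq (f p)) ?fr ?undup_uniq//= eqxx big1 ?addr0// => v.
  by rewrite eq_sym => /negPf ->.
by rewrite divff// gt_eqF// total_tent_gt0.
Qed.

(** The triangle inequality makes the tents 1-Lipschitz. *)
Lemma tent_continuous p : continuous (tent p).
Proof.
move=> x; apply/cvgrPdist_lt => eps eps0; near=> y.
have : ball x eps y by near: y; exact: nbhsx_ballx.
rewrite ballEmdist/= => xy.
have := metric_triangle p x y; have := metric_triangle p y x.
rewrite (metric_sym y x) /tent ltr_norml.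
case: (leP (e - mdist p x) 0); case: (leP (e - mdist p y) 0) => * //; lra.
Unshelve. all: by end_near. Qed.

Lemma weight_continuous v : continuous (weight ^~ v).
Proof.
move=> x; apply: cvgM.
  by apply: sum_continuous => p _; exact: tent_continuous.
apply: cvgV; first by rewrite gt_eqF// total_tent_gt0.
by apply: sum_continuous => p _; exact: tent_continuous.
Qed.

(** Continuity of the weights is uniform in v, because all of them vanish
outside of the finite image of s; this is what the sup distance of the weak
topology asks for. *)
Lemma weight_near x (d : R) : 0 < d ->
  \forall y \near x, forall v, `|weight x v - weight y v| < d.
Proof.
move=> d0.
have : \forall y \near x, forall v : seq_sub (map f s),
    `|weight x (val v) - weight y (val v)| < d.
  apply: filter_forall => v.
  have /cvgrPdist_lt := @weight_continuous (val v) x; exact.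
apply: filterS => y wxy v.
have [vs|vs] := boolP (v \in map f s); first exact: (wxy (SeqSub vs)).
have w0 z : weight z v = 0.
  by apply: contraNeq vs => /weight_neq0[p [ps <- _]]; exact: map_f.
by rewrite !w0 subrr normr0.
Qed.

Variable r : R.
(* The tents have radius e; the double radius leaves room for x to move while
   the supports stay in one simplex. *)
Hypothesis diam_f_ball : forall x, (diam (f @` ball x (e + e)) <= r%:E)%E.

Lemma weight_simplex x : simplex (vietoris_rips Y r) [set v | weight x v != 0].
Proof.
have wf : [set v | weight x v != 0] `<=` f @` ([set` s] `&` ball x e).
  move=> v /weight_neq0[p [ps <- px]]; exists p => //; split=> //.
  by rewrite ballEmdist/= metric_sym.
split.
- apply: sub_finite_set wf _; apply: finite_image; apply: finite_setIl.
  exact: finite_seq.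
- apply/set0P/eqP => w0; have /eqP := weight_sum1 x; apply/negP.
  rewrite fsbig1 1?eq_sym ?oner_neq0// => v _.
  by have [//|wv] := eqVneq (weight x v) 0; have : set0 v by rewrite -w0.
- apply: le_trans (diam_f_ball x); apply: le_diam => v /wf[p [_ px] <-].
  exists p => //; apply: le_ball px.
  by rewrite lerDl ltW.
Qed.

Definition nerve_map x : VR Y r :=
  RealizationPoint (weight_ge0 x) (weight_simplex x) (weight_sum1 x).

(** In the weak topology, continuity at x can be tested on a single simplex as
soon as this simplex carries the values at all points near x. Here it is the
image of the net points that are within twice the radius of x. *)
Lemma nerve_map_continuous : continuous nerve_map.
Proof.
apply/continuousP => U oU; rewrite openE => x Ux.
pose t := f @` ([set` s] `&` ball x (e + e)).
have near_t y : ball x e y -> [set v | weight y v != 0] `<=` t.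
  move=> xy v /weight_neq0[p [ps <- py]]; exists p => //; split=> //.
  by apply: ball_triangle xy _; rewrite ballEmdist/= metric_sym.
have Kt : simplex (vietoris_rips Y r) t.
  split.
  - by apply: finite_image; apply: finite_setIl; exact: finite_seq.
  - have [p ps px] := s_net x; exists (f p), p => //; split=> //.
    by apply: le_ball (ball_sym px); rewrite lerDl ltW.
  - apply: le_trans (diam_f_ball x); apply: le_diam.
    by apply: image_subset => p [].
have [d d0 dU] := oU t Kt (nerve_map x)
  (conj (near_t x (ballxx x e_gt0)) Ux).
apply: filterS2 (nbhsx_ballx x e e_gt0) (weight_near x d0) => y xy wy.
by apply: dU => //; exact: near_t.
Qed.

End partition_of_unity.

Section odd_map_of_odd_function.
Variables (R : realType) (X Y : involutiveMetricType R) (f : X -> Y).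
Hypothesis f_odd : odd_function f.

(** Symmetry of the net is asked for as a multiset: a net of the form
[s0 ++ map antip s0] has it even when it repeats points. *)
Lemma weight_antip (s : seq X) (e : R) x v :
  perm_eq (map antip s) s ->
  weight f s e (antip x) v = weight f s e x (antip v).
Proof.
move=> ss; have tentN p : tent e (antip p) (antip x) = tent e p x.
  by rewrite /tent mdist_antip.
congr (_ / _).
  rewrite -(perm_big _ ss)/= big_map; apply: eq_big => p; last by rewrite tentN.
  by rewrite f_odd (can2_eq (@antipK Y) (@antipK Y)).
rewrite /total_tent -(perm_big _ ss)/= big_map.
by under eq_bigr do rewrite tentN.
Qed.

(** The bound r is preserved exactly: all the simplices that are needed are
images of sets contained in balls below a Lebesgue number. *)
Lemma odd_map_of_odd_function (r : R) : compact [set: X] ->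
  (forall x, exists U : set X, [/\ open U, U x & (diam (f @` U) <= r%:E)%E]) ->
  exists g : X -> VR Y r, continuous g /\ odd_function g.
Proof.
move=> cptX fU.
have [e e0 diam_f] : exists2 e : R, 0 < e &
    forall x, (diam (f @` ball x e) <= r%:E)%E.
  apply: (compact_lebesgue_number cptX (P := fun A => diam (f @` A) <= r%:E)%E).
    by move=> A B AB; apply: le_trans; apply: le_diam; exact: image_subset.
  move=> x; have [U [oU Ux dU]] := fU x.
  have /nbhs_ballP[e e0 xU] : nbhs x U by exact: open_nbhs_nbhs.
  by exists e => //; apply: le_trans dU; apply: le_diam; exact: image_subset.
have e2 : 0 < e / 2 by rewrite divr_gt0.
have [s0 s0_net] := compact_finite_net cptX e2.
pose s := s0 ++ map antip s0.
have s_net x : exists2 p, p \in s & ball p (e / 2) x.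
  by have [p ps px] := s0_net x; exists p; rewrite // mem_cat ps.
have ss : perm_eq (map antip s) s.
  by rewrite /s map_cat (mapK (@antipK X)) perm_catC.
have diam_f2 x : (diam (f @` ball x (e / 2 + e / 2)) <= r%:E)%E.
  by rewrite -splitr.
exists (nerve_map e2 s_net diam_f2); split; first exact: nerve_map_continuous.
by move=> x; apply: realization_eq => v; exact: weight_antip.
Qed.

End odd_map_of_odd_function.

(** * From odd maps to odd functions *)

Section odd_selection.
Variables (R : realType) (X Y : involutiveMetricType R).

(** The choice operator depends on the pair of antipodal points alone, so that
it picks the same point for x and [antip x]. *)
Definition antipodal_rep (x : X) : X := xget x [set y | y = x \/ y = antip x].

Lemma antipodal_repP x : antipodal_rep x = x \/ antipodal_rep x = antip x.
Proof. by rewrite /antipodal_rep; case: xgetP => [y _ []|]; auto. Qed.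

Lemma antipodal_rep_antip x : antipodal_rep (antip x) = antipodal_rep x.
Proof.
rewrite /antipodal_rep antipK.
have -> : [set y | y = antip x \/ y = x] = [set y | y = x \/ y = antip x].
  by apply/seteqP; split => y /= [->|->]; auto.
by rewrite /xget; case: pselect => // -[]; exists x; apply/asboolP; left.
Qed.

(** Choose freely at the representative of each antipodal pair, and extend
oddly to the other point of the pair, which is distinct from it. *)
Lemma odd_selection (S : X -> Y -> Prop) :
  (forall x : X, antip x != x) ->
  (forall x, exists y, S x y) ->
  (forall x y, S x y -> S (antip x) (antip y)) ->
  exists f : X -> Y, odd_function f /\ forall x, S x (f x).
Proof.
move=> free /choice[h Sh] S_odd.
exists (fun x => if antipodal_rep x == x then h x else antip (h (antip x))).
split=> x; last first.
  by case: ifP => // _; rewrite -[x in S x]antipK; exact: S_odd.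
rewrite antipodal_rep_antip antipK.
have [->|->] := antipodal_repP x.
  by rewrite eqxx eq_sym (negPf (free x)).
by rewrite eqxx (negPf (free x)) antipK.
Qed.

End odd_selection.

Section dominant_vertex.
Variables (R : realType) (V : choiceType) (K : simplicialComplex V).
Implicit Types p q : realization R K.

Definition dominant_vertex p v := forall w, bary p w <= bary p v.

Lemma dominant_vertex_exists p : exists v, dominant_vertex p v.
Proof.
have /finite_seqP[s sp] := simplex_finite (bary_simplex p).
have [v0 pv0] := simplex_nonempty (bary_simplex p).
have v0s : v0 \in s by rewrite sp in pv0.
have [v _ vmax] := @arg_maxP _ _ _ (SeqSub v0s) xpredT (bary p \o val) isT.
exists (val v) => w.
have [->|pw] := eqVneq (bary p w) 0; first exact: bary_ge0.
have ws : w \in s by have : [set` s] w by rewrite -sp.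
exact: (vmax (SeqSub ws) isT).
Qed.

Lemma dominant_vertex_gt0 p v : dominant_vertex p v -> 0 < bary p v.
Proof.
move=> pv; have [w /= pw] := simplex_nonempty (bary_simplex p).
by apply: lt_le_trans (pv w); rewrite lt_def pw bary_ge0.
Qed.

(** Comparing all vertices with one dominant vertex m of p suffices: in a point
q near p, the coordinate at m is larger than that at any vertex outside of the
support of p, so no such vertex dominates q. *)
Lemma near_dominant_vertex p :
  \forall q \near p, forall v, dominant_vertex q v -> bary p v != 0.
Proof.
have [m pm] := dominant_vertex_exists p.
pose U := [set q : realization R K |
  0 < bary q m /\ forall v, bary p v = 0 -> bary q v < bary q m].
have Up : U p.
  by split=> [|v ->]; exact: dominant_vertex_gt0.
have oU : open U.
  move=> t Kt q0 [_ [q0m q0v]].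
  have /finite_seqP[s ts] := simplex_finite Kt.
  (* moving each coordinate by less than e brings m and v closer by at most
     2 e; only the finitely many vertices of the simplex t can be non-zero *)
  have : \forall e \near (0:R)^'+, 0 < e /\ e < bary q0 m /\
      forall v : seq_sub s, bary p (val v) = 0 ->
        bary q0 (val v) + e + e < bary q0 m.
    near=> e; split; first by near: e; exact: nbhs_right_gt.
    split; first by near: e; exact: nbhs_right_lt.
    near: e; apply: filter_forall => v.
    have [/q0v qv|pv] := eqVneq (bary p (val v)) 0; last first.
      by apply: nearW => e /eqP; rewrite (negPf pv).
    near=> e => _; suff : e < (bary q0 m - bary q0 (val v)) / 2 by lra.
    by near: e; apply: nbhs_right_lt; rewrite divr_gt0// subr_gt0.
  case/filter_ex => e [e0 [em ev]]; exists e => // q tq qe.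
  have := qe m; rewrite ltr_distl => /andP[_ qm].
  split=> [|v pv]; first lra.
  have [->|qv] := eqVneq (bary q v) 0; first lra.
  have vs : v \in s by have : [set` s] v by rewrite -ts; exact: tq.
  have := ev (SeqSub vs) pv; have := qe v.
  by rewrite /= ltr_distl => /andP[+ _]; lra.
apply: filterS (open_nbhs_nbhs (conj oU Up)) => q [_ qU] v qv.
by apply/eqP => /qU; rewrite ltNge qv.
Unshelve. all: by end_near. Qed.

End dominant_vertex.

Lemma dominant_vertex_antip (R : realType) (Y : involutiveMetricType R) (r : R)
    (p : VR Y r) v :
  dominant_vertex p v -> dominant_vertex (antip p) (antip v).
Proof. by move=> pv w; rewrite /antip/= antipK; exact: pv. Qed.

(** Near x the function f only takes values in the support of [g x], which has
diameter at most r. *)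
Lemma diam_dominant_vertex (R : realType) (X : topologicalType)
    (Y : metricType R) (r : R) (g : X -> VR Y r) (f : X -> Y) :
  continuous g -> (forall x, dominant_vertex (g x) (f x)) ->
  forall x, exists U : set X, [/\ open U, U x & (diam (f @` U) <= r%:E)%E].
Proof.
move=> cg gf x.
have := cg x _ (near_dominant_vertex (g x)).
rewrite nbhs_simpl/= nbhsE => -[U [oU Ux] Ug]; exists U; split=> //.
have [_ _ gr] := bary_simplex (g x); apply: le_trans gr; apply: le_diam.
by move=> _ [y Uy <-]; exact: Ug Uy _ (gf y).
Qed.

(** * The theorem *)

Theorem theorem1p3 (R : realType) (n k : nat) (nk : (n <= k)%N) :
  (forall f : sphere R k -> sphere R n, odd_function f ->
     (odd_map_threshold R n k <= modulus_of_discontinuity f)%E) /\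
  (forall eps : R, 0 < eps ->
     exists f : sphere R k -> sphere R n, odd_function f /\
       (modulus_of_discontinuity f <= odd_map_threshold R n k + eps%:E)%E).
Proof.
split=> [f f_odd|eps eps0].
  apply: le_ereal_inf => _ [d [d0 fd] <-]; exists d => //; split=> //.
  by apply: odd_map_of_odd_function f_odd _ _ fd; exact: sphere_compact.
(* for an infinite threshold, which does not occur, any odd function would do *)
have [toc|tfin] := eqVneq (odd_map_threshold R n k) +oo%E.
  have [|//|f [f_odd _]] := @odd_selection R (sphere R k) (sphere R n)
    (fun _ _ => True) (@sphere_antip_neq R k).
    by move=> x; exact: sphere_nonempty.
  by exists f; split=> //; rewrite toc addye// leey.
have t_fin : odd_map_threshold R n k \is a fin_num.
  rewrite ge0_fin_numE ?ltey//; apply: le_ereal_inf_tmp => _ [r [r0 _] <-].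
  by rewrite lee_fin.
have [_ [r [r0 [g [cg g_odd]]] <-] rt] := lb_ereal_inf_adherent eps0 t_fin.
have [||f [f_odd gf]] := @odd_selection R _ _ (fun x => dominant_vertex (g x))
    (@sphere_antip_neq R k).
- by move=> x; exact: dominant_vertex_exists.
- by move=> x y; rewrite g_odd; exact: dominant_vertex_antip.
exists f; split=> //; apply: le_trans (ltW rt); apply: ereal_inf_lbound.
by exists r => //; split=> //; exact: diam_dominant_vertex gf.
Qed.
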